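(* Any flat virtual knot can be deformed into the trivial knot by a finite sequence of flat $\Xi$-moves; that is, the flat $\Xi$-move is an unknotting operation for flat virtual knots.
   Context: **Gauss diagrams and virtual knots.** A Gauss diagram is an oriented circle with finitely many chords, each having a sign $\pm1$ and an orientation (from its initial to its terminal endpoint), whose endpoints are distinct points of the circle; it is considered up to orientation-preserving homeomorphism of the circle, i.e. only the cyclic order of endpoints matters. Endpoints are called consecutive (adjacent) if no other endpoints lie between them on the circle. A virtual knot is an equivalence class of Gauss diagrams under the Reidemeister moves (a Gauss diagram in the class is called a Gauss diagram of the knot): - Move I: add or remove a chord (any sign and orientation) whose two endpoints are adjacent. - Move II: add or remove two chords of opposite signs whose initial endpoints are adjacent and whose terminal endpoints are adjacent. - Move III: suppose there are three pairwise disjoint arcs $T,M,B$ of the circle and three chords $c_{TM}$, $c_{TB}$, $c_{MB}$, oriented from $T$ to $M$, from $T$ to $B$, from $M$ to $B$ respectively, with signs $e_{TM},e_{TB},e_{MB}$, such that each arc contains exactly two endpoints, both belonging to these chords. Put $\delta_T=+1$ if $c_{TM}$ comes before $c_{TB}$ along $T$ (else $-1$), $\delta_M=+1$ if $c_{TM}$ comes before $c_{MB}$ along $M$ (else $-1$), $\delta_B=+1$ if $c_{TB}$ comes before $c_{MB}$ along $B$ (else $-1$). If for some $c\in\{\pm1\}$ one has $\delta_T=c\,e_{TB}$, $\delta_M=c\,e_{MB}$, $\delta_B=c\,e_{TM}e_{TB}e_{MB}$, then the move exchanges the two endpoints on each of the three arcs. (Equivalently, virtual knots are virtual knot diagrams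 modulo generalized Reidemeister moves; chords correspond to real crossings, oriented from over to under.) The trivial knot is represented by the Gauss diagram with no chords. **Flat virtual knots.** A crossing change on a Gauss diagram simultaneously reverses the orientation and the sign of one chord. A flat virtual knot is an equivalence class of virtual knots up to crossing changes (i.e. of Gauss diagrams up to Reidemeister moves and crossing changes). Equivalently, it is represented by a virtual knot diagram with all real crossings replaced by flat crossings (transverse double points with no over/under information). **Flat $\Xi$-move.** Let $P_1,P_2,P_3$ be three consecutive endpoints of chords of a Gauss diagram. A $\Xi$-move exchanges the positions of $P_1$ and $P_3$, preserving the signs and orientations of the chords (so if $P_1,P_3$ are the two endpoints of one chord, the move interchanges its initial and terminal endpoints on the circle). A flat $\Xi$-move is a $\Xi$-move with all real crossings replaced by flat ones, i.e. the move induced by a $\Xi$-move on Gauss diagrams considered up to crossing changes; two flat virtual knots are related by a flat $\Xi$-move if they have representing Gauss diagrams related by a $\Xi$-move. *)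

(* Defs.v *)
From Stdlib Require Export Relations.
From mathcomp Require Export all_boot.

Set Implicit Arguments.
Unset Strict Implicit.
Unset Printing Implicit Defensive.

(** Gauss diagrams are encoded by Gauss words: the endpoints of the chords are
    read along the oriented circle from an arbitrary base point, and chords are
    named by natural numbers.  The choices of base point and of names are
    divided out by [gauss_iso]. *)

(** Signs form the group {+1, -1}, written additively as (bool, (+)):
    [false] is +1 and [true] is -1. *)
Definition sign := bool.

(** A chord is (name, sign); the boolean of an endpoint is [true] for the
    initial endpoint and [false] for the terminal one. *)
Definition chord : eqType := (nat * sign)%type.
Definition endpoint : eqType := (chord * bool)%type.

Definition ini (c : chord) : endpoint := (c, true).
Definition ter (c : chord) : endpoint := (c, false).

Definition name (x : endpoint) : nat := x.1.1.
Definition is_ini (x : endpoint) : bool := x.2.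
Definition other_end (x : endpoint) : endpoint := (x.1, ~~ x.2).

(** Every name that occurs does so exactly twice, once as an initial and once as
    a terminal endpoint, with the same sign. *)
Definition gauss_word (s : seq endpoint) : bool :=
  uniq [seq (name x, is_ini x) | x <- s] && all (fun x => other_end x \in s) s.

Record gauss_diagram := GaussDiagram {
  word :> seq endpoint;
  wordP : gauss_word word
}.

Definition empty_diagram : gauss_diagram := @GaussDiagram [::] isT.

Definition rename (f : nat -> nat) (x : endpoint) : endpoint :=
  ((f x.1.1, x.1.2), x.2).

Definition gauss_iso (D E : gauss_diagram) : Prop :=
  exists (k : nat) (f : nat -> nat),
    injective f /\ word E = rot k [seq rename f x | x <- word D].

(** Two adjacent endpoints, [x] coming first if [d] is +1 and [y] coming first
    if [d] is -1. *)
Definition arc (d : sign) (x y : endpoint) : seq endpoint :=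
  if d then [:: y; x] else [:: x; y].

(** In each move below the base point sits at the beginning of one of the arcs
    involved; the other positions are obtained by [gauss_iso].  Names of added
    chords are automatically new, as moves are only used between words
    satisfying [gauss_word]. *)
Inductive reidemeister : seq endpoint -> seq endpoint -> Prop :=
| Move_I (c : chord) (d : sign) (s : seq endpoint) :
    reidemeister s (arc d (ini c) (ter c) ++ s)
| Move_II (a b : nat) (e d1 d2 : sign) (u v : seq endpoint) :
    reidemeister (u ++ v)
      (arc d1 (ini (a, e)) (ini (b, ~~ e)) ++ u ++
       arc d2 (ter (a, e)) (ter (b, ~~ e)) ++ v)
(* Move III, with the arcs in the cyclic order T, M, B *)
| Move_III_TMB (tm tb mb : nat) (eTM eTB eMB dT dM dB c : sign)
    (u v w : seq endpoint) :
    dT = c (+) eTB -> dM = c (+) eMB -> dB = c (+) (eTM (+) eTB (+) eMB) ->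
    reidemeister
      (arc dT (ini (tm, eTM)) (ini (tb, eTB)) ++ u ++
       arc dM (ter (tm, eTM)) (ini (mb, eMB)) ++ v ++
       arc dB (ter (tb, eTB)) (ter (mb, eMB)) ++ w)
      (arc (~~ dT) (ini (tm, eTM)) (ini (tb, eTB)) ++ u ++
       arc (~~ dM) (ter (tm, eTM)) (ini (mb, eMB)) ++ v ++
       arc (~~ dB) (ter (tb, eTB)) (ter (mb, eMB)) ++ w)
(* Move III, with the arcs in the cyclic order T, B, M *)
| Move_III_TBM (tm tb mb : nat) (eTM eTB eMB dT dM dB c : sign)
    (u v w : seq endpoint) :
    dT = c (+) eTB -> dM = c (+) eMB -> dB = c (+) (eTM (+) eTB (+) eMB) ->
    reidemeister
      (arc dT (ini (tm, eTM)) (ini (tb, eTB)) ++ u ++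
       arc dB (ter (tb, eTB)) (ter (mb, eMB)) ++ v ++
       arc dM (ter (tm, eTM)) (ini (mb, eMB)) ++ w)
      (arc (~~ dT) (ini (tm, eTM)) (ini (tb, eTB)) ++ u ++
       arc (~~ dB) (ter (tb, eTB)) (ter (mb, eMB)) ++ v ++
       arc (~~ dM) (ter (tm, eTM)) (ini (mb, eMB)) ++ w).

Definition change_at (n : nat) (x : endpoint) : endpoint :=
  if name x == n then ((n, ~~ x.1.2), ~~ x.2) else x.

Definition crossing_change (D E : gauss_diagram) : Prop :=
  exists n : nat, word E = [seq change_at n x | x <- word D].

Definition flat_step (D E : gauss_diagram) : Prop :=
  [\/ gauss_iso D E, reidemeister D E | crossing_change D E].

Definition flat_equiv : gauss_diagram -> gauss_diagram -> Prop :=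
  clos_refl_sym_trans gauss_diagram flat_step.

(** Flat virtual knots are the equivalence classes of [flat_equiv]. *)
Record flat_virtual_knot := FlatVirtualKnot {
  represents :> gauss_diagram -> Prop;
  representsP : exists D : gauss_diagram, represents = flat_equiv D
}.

Definition flat_class (D : gauss_diagram) : flat_virtual_knot :=
  @FlatVirtualKnot (flat_equiv D) (ex_intro _ D erefl).

Definition trivial_flat_knot : flat_virtual_knot := flat_class empty_diagram.

(** The base point is just before [P1]; as in [reidemeister], this is no
    restriction up to [gauss_iso]. *)
Definition Xi_move (D E : gauss_diagram) : Prop :=
  exists (P1 P2 P3 : endpoint) (s : seq endpoint),
    word D = [:: P1, P2, P3 & s] /\ word E = [:: P3, P2, P1 & s].

Definition flat_Xi_move (K L : flat_virtual_knot) : Prop :=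
  exists D E : gauss_diagram, [/\ K D, L E & Xi_move D E].

(* Main.v *)
Require Import Defs.
From Stdlib Require Import Relations.
From mathcomp Require Import all_boot.
From Stdlib Require Import FunctionalExtensionality PropExtensionality.
From Stdlib Require Import ProofIrrelevance.

Set Implicit Arguments.
Unset Strict Implicit.

(** A [Xi]-move exchanges two endpoints at distance two, so endpoints can be
    permuted freely among the positions of a given parity.  A chord whose ends
    have opposite parities can thus be isolated and removed by move I.  If there
    is no such chord, a chord with both ends even and a chord with both ends odd
    can be brought to the interleaved position [x y x y]; a [Xi]-move on the two
    ends of one chord followed by its crossing change alters only its sign, so
    one can always arrange that move II removes the pair. *)

(** Extensionality turns the pointwise equivalence of the two classes into an equality of
    predicates; proof irrelevance then identifies the witnesses. *)
Lemma flat_knot_eq (K L : flat_virtual_knot) (D : gauss_diagram) :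
  K D -> L D -> K = L.
Proof.
case: K L => r [A rA] [r' [B r'B]] /=; subst r r' => AD BD.
have AB E : flat_equiv A E <-> flat_equiv B E.
  by split=> H; [apply: rst_trans BD _; apply: rst_trans (rst_sym _ _ _ _ AD) H
                |apply: rst_trans AD _; apply: rst_trans (rst_sym _ _ _ _ BD) H].
have eqAB : flat_equiv A = flat_equiv B.
  by apply: functional_extensionality => E; apply: propositional_extensionality.
move: (ex_intro _ A _) (ex_intro _ B _); rewrite eqAB => p q.
by rewrite (proof_irrelevance _ p q).
Qed.

Definition unknots (D : gauss_diagram) : Prop :=
  clos_refl_trans flat_virtual_knot flat_Xi_move (flat_class D) trivial_flat_knot.

Lemma unknots_flat_equiv (D E : gauss_diagram) :
  flat_equiv D E -> unknots E -> unknots D.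
Proof.
move=> DE; rewrite /unknots (@flat_knot_eq (flat_class D) (flat_class E) E) //.
exact: rst_refl.
Qed.

Lemma unknots_Xi_move (D E : gauss_diagram) :
  Xi_move D E -> unknots E -> unknots D.
Proof.
move=> DE; apply: rt_trans; apply: rt_step.
by exists D, E; split=> //; apply: rst_refl.
Qed.

Lemma gauss_word_perm (s t : seq endpoint) :
  perm_eq s t -> gauss_word s = gauss_word t.
Proof.
move=> st; rewrite /gauss_word (perm_uniq (perm_map _ st)) (perm_all _ st).
by congr (_ && _); apply: eq_all => x; rewrite (perm_mem st).
Qed.

Lemma other_endK : involutive other_end.
Proof. by case=> c b; rewrite /other_end negbK. Qed.

Lemma gauss_word_notin (x y : endpoint) (s : seq endpoint) :
  gauss_word (x :: s) -> y \in s -> (name y, is_ini y) != (name x, is_ini x).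
Proof.
case/andP=> /= /andP[xNs _] _ ys; apply: contra xNs => /eqP <-.
by apply: (map_f (fun z => (name z, is_ini z))).
Qed.

Lemma gauss_word_other_end (x : endpoint) (s : seq endpoint) :
  gauss_word (x :: s) -> other_end x \in s.
Proof.
case/andP=> _ /= /andP[+ _]; rewrite inE => /orP[/eqP|//].
by case: x => c [].
Qed.

Lemma gauss_word_behead2 (x : endpoint) (s : seq endpoint) :
  gauss_word [:: x, other_end x & s] -> gauss_word s.
Proof.
move=> xs; have xs' : gauss_word [:: other_end x, x & s].
  by rewrite -(@gauss_word_perm [:: x, other_end x & s]) // (perm_catCA [:: _] [:: _]).
have [/= /and3P[_ _ us] /and3P[_ _ /allP sub]] := andP xs.
apply/andP; split=> //; apply/allP=> y ys.
have := sub y ys; rewrite !inE => /or3P[/eqP yx|/eqP yx|//].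
- have y_in : y \in x :: s by rewrite inE ys orbT.
  by have := gauss_word_notin xs' y_in; rewrite -yx other_endK eqxx.
- have y_in : y \in other_end x :: s by rewrite inE ys orbT.
  by have := gauss_word_notin xs y_in; rewrite -[y]other_endK yx other_endK eqxx.
Qed.

Lemma gauss_word_change (n : nat) (s : seq endpoint) :
  gauss_word s -> gauss_word (map (change_at n) s).
Proof.
case/andP=> us /allP sub; apply/andP; split.
(* [f] is the effect of the crossing change on (name, orientation) pairs; its injectivity preserves
   uniqueness. *)
- pose f (p : nat * bool) := (p.1, p.2 (+) (p.1 == n)).
  have f_inj : injective f.
    move=> [m b] [m' b'] [<-]; case: eqP => _; rewrite ?addbT ?addbF.
      by move/negb_inj ->.
    by move=> ->.
  rewrite -(map_inj_uniq f_inj) -map_comp in us; rewrite -map_comp.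
  congr (uniq _): us; apply: eq_map => -[[m e] b].
  rewrite /f /change_at /name /is_ini /=.
  by case: eqP => [->|_]; rewrite /= ?addbT ?addbF.
- apply/allP=> _ /mapP[x xs ->]; have -> : other_end (change_at n x) = change_at n (other_end x).
    by case: x {xs} => [[m e] b]; rewrite /other_end /change_at /name /=; case: eqP.
  exact: map_f (sub x xs).
Qed.

(** Quantifying over the proof of [gauss_word] lets raw words be rewritten backwards by the moves,
    with validity needed only where a move is justified. *)
Definition unknottable (s : seq endpoint) : Prop :=
  forall h : gauss_word s, unknots (GaussDiagram h).

Lemma unknottable_rot (k : nat) (s : seq endpoint) :
  unknottable (rot k s) -> unknottable s.
Proof.
move=> H h; have h' : gauss_word (rot k s).
  by rewrite (@gauss_word_perm _ s) // perm_rot.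
apply: unknots_flat_equiv (H h'); apply: rst_step; apply: Or31.
exists k, id; split=> //=; congr rot; rewrite -[LHS]map_id.
by apply: eq_map => -[[]].
Qed.

Lemma unknottable_Xi (p s : seq endpoint) (x y z : endpoint) :
  unknottable (p ++ [:: z, y, x & s]) -> unknottable (p ++ [:: x, y, z & s]).
Proof.
(* Rotating past [p] puts the base point just before [x], as [Xi_move] requires; [H'] undoes the
   rotation. *)
move=> H; apply: (@unknottable_rot (size p)); rewrite rot_size_cat => h.
have H' : unknottable [:: z, y, x & s ++ p].
  apply: (@unknottable_rot (size [:: z, y, x & s])).
  by rewrite -[X in rot _ X]/([:: z, y, x & s] ++ p) rot_size_cat.
have h' : gauss_word [:: z, y, x & s ++ p].
  rewrite -(@gauss_word_perm ([:: x; y; z] ++ (s ++ p))) //.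
  by rewrite (perm_cat2r (s ++ p) _ [:: z; y; x]) -(perm_rev [:: x; y; z]) perm_refl.
by apply: unknots_Xi_move (H' h'); exists x, y, z, (s ++ p).
Qed.

Lemma unknottable_change (n : nat) (s : seq endpoint) :
  unknottable (map (change_at n) s) -> unknottable s.
Proof.
move=> H h; apply: unknots_flat_equiv (H (gauss_word_change n h)).
by apply: rst_step; apply: Or33; exists n.
Qed.

Lemma unknottable_isolated (x : endpoint) (s : seq endpoint) :
  unknottable s -> unknottable [:: x, other_end x & s].
Proof.
move=> H h; apply: unknots_flat_equiv (H (gauss_word_behead2 h)).
apply: rst_sym; apply: rst_step; apply: Or32 => /=; case: x h => c [] h.
- exact: (Move_I c false).
- exact: (Move_I c true).
Qed.

Lemma unknottable_cancel (a b : nat) (e : sign) (s : seq endpoint) :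
  unknottable s ->
  unknottable [:: ini (a, e), ini (b, ~~ e), ter (a, e), ter (b, ~~ e) & s].
Proof.
move=> H h; have h' : gauss_word s.
  apply: (@gauss_word_behead2 (ini (b, ~~ e))).
  apply: (@gauss_word_behead2 (ini (a, e))).
  rewrite -(gauss_word_perm (s := [:: ini (a, e), ini (b, ~~ e), ter (a, e), ter (b, ~~ e) & s])) //.
  by rewrite perm_cons (perm_catCA [:: _] [:: _]).
apply: unknots_flat_equiv (H h'); apply: rst_sym; apply: rst_step.
by apply: Or32; apply: (@Move_II a b e false false [::] s).
Qed.

(** The hypothesis covers every word of the length of [s] because [change_at] is mapped over the
    tail too. *)
Lemma unknottable_parallel (a b : nat) (e e' : sign) (s : seq endpoint) :
  a != b -> (forall t, size t = size s -> unknottable t) ->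
  unknottable [:: ini (a, e), ini (b, e'), ter (a, e), ter (b, e') & s].
Proof.
move=> ab H; have [->|->] : e' = ~~ e \/ e' = e by case: e e' => -[]; [right|left|left|right].
  by apply: unknottable_cancel; apply: H.
(* Equal signs: the move exchanges the ends of [a], and the crossing change puts its initial end
   first again, with the opposite sign. *)
apply: (@unknottable_Xi [::]) => /=; apply: (@unknottable_change a) => /=.
rewrite /change_at /name /= eqxx (eq_sym b) (negbTE ab).
have := @unknottable_cancel a b (~~ e); rewrite negbK; apply.
by apply: H; rewrite size_map.
Qed.

Lemma unknottable_interleaved (x y : endpoint) (s : seq endpoint) :
  (forall t, size t = size s -> unknottable t) ->
  unknottable [:: x, y, other_end x, other_end y & s].
Proof.
move=> H h; have ab : name x != name y.
  case/andP: h => /= /and3P[xN _ _] _; apply: contraNneq xN => xy.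
  rewrite !inE /name /is_ini /= -/(name x) -/(name y) xy !xpair_eqE eqxx /=.
  by case: x.2 y.2 => -[].
move: h; rewrite -/(unknottable _).
case: x y ab => [[a e] i] [[b e'] j]; rewrite /name /= => ab.
have ba : (b == a) = false by rewrite eq_sym (negbTE ab).
(* Crossing changes make the first end of each chord initial, here for [a], further down for [b]. *)
wlog -> : i e s H / i = true => [Hi|].
  case: i; first exact: Hi.
  apply: (@unknottable_change a); rewrite /= /change_at /name /= eqxx ba.
  by apply: Hi => // t; rewrite size_map; apply: H.
case: j; first exact: unknottable_parallel.
apply: (@unknottable_change b); rewrite /= /change_at /name /= eqxx (negbTE ab).
by apply: unknottable_parallel => // t; rewrite size_map; apply: H.
Qed.

(** One move turns [c d y] into [y d c], so [y] crosses an even [u] two endpoints at a time. Only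
    the length of [w] is recorded, as the main induction is on length. *)
Lemma unknottable_pull (p u v : seq endpoint) (y : endpoint) :
  ~~ odd (size u) ->
  exists2 w, size w = size u + size v &
    unknottable (p ++ y :: w) -> unknottable (p ++ u ++ y :: v).
Proof.
have [n] := ubnP (size u); elim: n p u => // n IHn p [|c [|d u]] //=; first by exists v.
rewrite ltnS negbK => /ltnW le_u ev.
have [w sz_w Hw] := IHn (p ++ [:: c; d]) u le_u ev.
exists [:: d, c & w]; first by rewrite /= sz_w.
by move=> H; rewrite -!catA /= in Hw; apply: Hw; apply: unknottable_Xi.
Qed.

(** An even number of endpoints between the ends of a chord means that their positions have opposite
    parities. *)
Lemma unknottable_opposite_parity (x : endpoint) (u v : seq endpoint) :
  ~~ odd (size u) ->
  (forall t, size t = size u + size v -> unknottable t) ->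
  unknottable (x :: u ++ other_end x :: v).
Proof.
move=> ev H; have [w sz_w Hw] := unknottable_pull [:: x] v (other_end x) ev.
by apply: Hw; apply: unknottable_isolated; apply: H.
Qed.

Lemma unknottable_all (s : seq endpoint) : unknottable s.
Proof.
have [n] := ubnP (size s); elim: n s => // n IHn [|x s] /=.
  by move=> _ h; rewrite (bool_irrelevance h isT); apply: rt_refl.
rewrite ltnS => le_s h; have xs := gauss_word_other_end h.
move: h; rewrite -/(unknottable _); case/splitPr: xs le_s => u v le_s.
have [ev|] := boolP (~~ odd (size u)).
  apply: unknottable_opposite_parity => // t sz_t; apply: IHn.
  by move: le_s; rewrite size_cat /= addnS -sz_t; apply: ltnW.
(* An odd [u] has a first endpoint [y], and the even rest lets [other_end x] be pulled to just after
   [y]. *)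
case: u le_s => [|y u] //= le_s; rewrite negbK => ev.
have [w sz_w Hw] := unknottable_pull [:: x; y] v (other_end x) ev.
apply: Hw => h.
(* The other end of [y] can be neither [x] nor [other_end x], by uniqueness of endpoints. *)
have yw : other_end y \in w.
  have y_in : y \in [:: y, other_end x & w] by rewrite mem_head.
  have h' : gauss_word [:: y, other_end x & rcons w x].
    rewrite -(gauss_word_perm (s := [:: x, y, other_end x & w])) // -cats1.
    by rewrite (perm_catC [:: x] [:: y, other_end x & w]).
  have := gauss_word_other_end h'; rewrite inE mem_rcons inE.
  case/or3P=> // /eqP yx.
    by have := gauss_word_notin h y_in; rewrite -[y]other_endK yx other_endK eqxx.
  by have := gauss_word_notin h' (mem_head _ _); rewrite -yx other_endK eqxx.
move: h; rewrite -/(unknottable _); case/splitPr: yw sz_w => u' v' sz_w.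
rewrite size_cat /= in sz_w; rewrite size_cat /= addnS -sz_w addnS in le_s.
(* If [u'] is even, pulling [other_end y] across it interleaves the two chords. *)
have [ev'|odd'] := boolP (~~ odd (size u')).
  have [w' sz_w' Hw'] := unknottable_pull [:: x; y; other_end x] v' (other_end y) ev'.
  apply: Hw'; apply: unknottable_interleaved => t sz_t; apply: IHn.
  by rewrite sz_t sz_w' /=; do 3!apply: ltnW.
(* If [u'] is odd, then [other_end x :: u'] is even, so the chord of [y], read from [y], has ends of
   opposite parities and is removed alone. *)
apply: (@unknottable_rot 1); rewrite rot1_cons /= rcons_cat /=.
apply: (@unknottable_opposite_parity y (other_end x :: u')) => //= t sz_t.
by apply: IHn; rewrite sz_t size_rcons addSn addnS; apply: ltnW.
Qed.

Theorem corollary1p4 (K : flat_virtual_knot) :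
  clos_refl_trans flat_virtual_knot flat_Xi_move K trivial_flat_knot.
Proof.
have [D KD] := representsP K.
have -> : K = flat_class D.
  by apply: (@flat_knot_eq _ _ D); rewrite /= ?KD; apply: rst_refl.
by case: D {KD} => s h; apply: unknottable_all.
Qed.
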